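(* Let $\ell=2n-1$ with $n\in\mathbb Z_{\ge2}$, and let $j=n$. Let $\widehat P\in\widehat{\mathcal{MV}}$ and $P=\Phi^{-1}(\widehat P)\in\mathcal{MV}^\omega$. Let $\mu_\bullet=(\mu_w)_{w\in W}$ and $\mu'_\bullet=(\mu'_w)_{w\in W}$ be the GGMS data of $P$ and of $f_n^\omega P$, respectively, let $c=M_{\Lambda_n}-M_{s_n\Lambda_n}-1$ where $(M_\gamma)_{\gamma\in\Gamma}=D(\mu_\bullet)$, and put $\sigma(h)=s_n\cdot h+ch_n$ for $h\in\mathfrak h$. Then $\widetilde P(\mu'_\bullet)$ is the smallest convex polytope (with respect to inclusion) among the polytopes $\widetilde P=\widetilde P(\mu''_\bullet)\in\widetilde{\mathcal P}$ with GGMS datum $\mu''_\bullet=(\mu''_w)_{w\in W}\in\mathcal V^\omega$ such that the following hold (that is, $\widetilde P(\mu'_\bullet)$ itself satisfies them with $\mu''_\bullet=\mu'_\bullet$, and it is contained in every such $\widetilde P$): (i) $\mu''_w=\mu_w$ for all $w\in W^\omega_-$, (ii) $\mu''_e=\mu_e-h_n^\omega$, (iii) $\widetilde P$ contains $\mu_w$ for all $w\in W^\omega_+$, and (iv) if $w\in W^\omega_-$ is such that $\langle\alpha_n,\mu_w\rangle\ge c$, then $\widetilde P$ contains $\sigma(\mu_w)$.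
   Context: **Type $A$ data.** Let $\ell=2n-1$ with $n\ge2$, $I=\{1,\dots,\ell\}$, and let $\mathfrak g$ be the simple Lie algebra over $\mathbb C$ of type $A_\ell$ with Cartan subalgebra $\mathfrak h$, simple coroots $h_j\in\mathfrak h$, simple roots $\alpha_j\in\mathfrak h^*$, fundamental weights $\Lambda_j\in\mathfrak h^*$ ($j\in I$), Cartan matrix $a_{ij}=\langle\alpha_j,h_i\rangle$, and Weyl group $W=\langle s_i\mid i\in I\rangle$ with unit $e$ and longest element $w_0$; $>$ is the (weak) Bruhat order ($ws_i>w$ iff right multiplication by $s_i$ raises the length; similarly on the left). Put $\mathfrak h_{\mathbb R}=\bigoplus_j\mathbb R h_j$ and $\Gamma=\{w\Lambda_i\mid w\in W,i\in I\}$. For $w\in W$ and $h,h'\in\mathfrak h_{\mathbb R}$ write $h\ge_w h'$ if $w^{-1}h-w^{-1}h'\in\sum_j\mathbb R_{\ge0}h_j$. **Pseudo-Weyl and MV polytopes.** $\mathcal V$ is the set of families $\mu_\bullet=(\mu_w)_{w\in W}$ in $\mathfrak h_{\mathbb R}$ with $\mu_{w'}\ge_w\mu_w$ for all $w,w'\in W$ and $\mu_{w_0}=0$. For $\mu_\bullet\in\mathcal V$ let $P(\mu_\bullet)=\{h\in\mathfrak h_{\mathbb R}\mid h\ge_w\mu_w\ \forall w\in W\}$; it determines $\mu_\bullet$, called its GGMS datum. Put $D(\mu_\bullet)=(M_\gamma)_{\gamma\in\Gamma}$ with $M_{w\Lambda_i}=\langle w\Lambda_i,\mu_w\rangle$ (well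 defined). $P(\mu_\bullet)$ is an MV polytope for $\mathfrak g$ if all $M_\gamma\in\mathbb Z$ and, for all $w\in W$ and $i\ne j$ in $I$ with $ws_i>w$, $ws_j>w$, $a_{ij}=a_{ji}=-1$, $$M_{ws_i\Lambda_i}+M_{ws_j\Lambda_j}=\min\bigl(M_{w\Lambda_i}+M_{ws_is_j\Lambda_j},\ M_{ws_js_i\Lambda_i}+M_{w\Lambda_j}\bigr).$$ $\mathcal{MV}$ is the set of MV polytopes for $\mathfrak g$. **Kashiwara operators on $\mathcal{MV}$.** For $j\in I$ and $P=P(\mu_\bullet)\in\mathcal{MV}$, $f_jP$ is the unique MV polytope $P(\mu'_\bullet)\in\mathcal{MV}$ with $\mu'_e=\mu_e-h_j$ and $\mu'_w=\mu_w$ for all $w\in W$ with $s_jw<w$ (existence and uniqueness are known, due to Kamnitzer). **Diagram automorphism.** $\omega:I\to I$, $\omega(j)=\ell-j+1$; $\omega$ also denotes the induced involutions of $\mathfrak g$ (permuting the Chevalley generators), of $\mathfrak h$ ($h_j\mapsto h_{\omega(j)}$) and of $W$ ($s_i\mapsto s_{\omega(i)}$); $\mathfrak g^\omega,\mathfrak h^\omega,W^\omega$ are the fixed points. For $\mu_\bullet\in\mathcal V$, $\omega(\mu_\bullet)=(\omega(\mu_{\omega(w)}))_{w\in W}\in\mathcal V$; $\mathcal V^\omega=\{\mu_\bullet\in\mathcal V\mid\omega(\mu_\bullet)=\mu_\bullet\}$. $\mathcal{MV}^\omega$ is the set of $P(\mu_\bullet)\in\mathcal{MV}$ with $\mu_\bullet\in\mathcal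 V^\omega$, equivalently with $\omega(P)=P$. **Operators $f_j^\omega$, elements $s_j^\omega$, $h_j^\omega$** ($j\in\widehat I=\{1,\dots,n\}$). For $1\le j\le n-1$: $f_j^\omega=f_jf_{\omega(j)}$, $s_j^\omega=s_js_{\omega(j)}$, $h_j^\omega=h_j+h_{\omega(j)}$. For $j=n$ (here $\ell=2n-1$): $f_n^\omega=f_n$, $s_n^\omega=s_n$, $h_n^\omega=h_n$. The operators $f_j^\omega$ preserve $\mathcal{MV}^\omega$. With $j=n$, $W^\omega_+=\{w\in W^\omega\mid s_n^\omega w>w\}$ and $W^\omega_-=\{w\in W^\omega\mid s_n^\omega w<w\}$. **Polytopes $\widetilde P$.** For $\mu_\bullet\in\mathcal V^\omega$, $\widetilde P(\mu_\bullet)=\{h\in\mathfrak h_{\mathbb R}\mid h\ge_w\mu_w\text{ for all }w\in W^\omega\}$, a convex polytope in $\mathfrak h_{\mathbb R}$; $\mu_\bullet$ is called its GGMS datum. $\widetilde{\mathcal P}=\{\widetilde P(\mu_\bullet)\mid\mu_\bullet\in\mathcal V^\omega\}$. **The fixed point algebra and $\widehat{\mathcal{MV}}$.** $\mathfrak g^\omega$ is simple of type $C_n$ with Cartan subalgebra $\mathfrak h^\omega$ and simple coroots $h_j^\omega$, $j\in\widehat I$. Let $\widehat A=(\widehat a_{ij})$ be its Cartan matrix ($\widehat a_{ij}$ is the value of the $j$-th simple root on $h_i^\omega$), $\widehat\Lambda_i\in(\mathfrak h^\omega)^*$ its fundamental weights, $\widehat W=\langle\widehat s_i\mid i\in\widehat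 I\rangle$ its Weyl group with unit $\widehat e$ and longest element $\widehat w_0$. There is a group isomorphism $\Theta:\widehat W\to W^\omega$ with $\Theta(\widehat s_i)=s_i^\omega$. On $\mathfrak h^\omega\cap\mathfrak h_{\mathbb R}$, $h\ge_{\widehat w}h'$ means $\widehat w^{-1}h-\widehat w^{-1}h'\in\sum_{j\in\widehat I}\mathbb R_{\ge0}h_j^\omega$. $\widehat{\mathcal V}$ is the set of families $(\widehat\mu_{\widehat w})_{\widehat w\in\widehat W}$ in $\mathfrak h^\omega\cap\mathfrak h_{\mathbb R}$ with $\widehat\mu_{\widehat w'}\ge_{\widehat w}\widehat\mu_{\widehat w}$ for all $\widehat w,\widehat w'$ and $\widehat\mu_{\widehat w_0}=0$; $\widehat P(\widehat\mu_\bullet)=\{h\in\mathfrak h^\omega\cap\mathfrak h_{\mathbb R}\mid h\ge_{\widehat w}\widehat\mu_{\widehat w}\ \forall\widehat w\}$; $\widehat M_{\widehat w\widehat\Lambda_i}=\langle\widehat w\widehat\Lambda_i,\widehat\mu_{\widehat w}\rangle$. $\widehat P(\widehat\mu_\bullet)$ is an MV polytope for $\mathfrak g^\omega$ (an element of $\widehat{\mathcal{MV}}$) if all $\widehat M_{\widehat\gamma}\in\mathbb Z$ and, for all $w\in\widehat W$ and $i\ne j$ in $\widehat I$ with $w\widehat s_i>w$, $w\widehat s_j>w$ (writing $s,\Lambda,M,a$ for $\widehat s,\widehat\Lambda,\widehat M,\widehat a$), either $a_{ij}=a_{ji}=0$, or (1) $a_{ij}=a_{ji}=-1$ and $M_{ws_i\Lambda_i}+M_{ws_j\Lambda_j}=\min(M_{w\Lambda_i}+M_{ws_is_j\Lambda_j},\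 M_{ws_js_i\Lambda_i}+M_{w\Lambda_j})$; or (2) $a_{ij}=-1,a_{ji}=-2$ and $M_{ws_j\Lambda_j}+M_{ws_is_j\Lambda_j}+M_{ws_i\Lambda_i}=\min(2M_{ws_is_j\Lambda_j}+M_{w\Lambda_i},\ 2M_{w\Lambda_j}+M_{ws_is_js_i\Lambda_i},\ M_{w\Lambda_j}+M_{ws_js_is_j\Lambda_j}+M_{ws_i\Lambda_i})$, $M_{ws_js_i\Lambda_i}+2M_{ws_is_j\Lambda_j}+M_{ws_i\Lambda_i}=\min(2M_{w\Lambda_j}+2M_{ws_is_js_i\Lambda_i},\ 2M_{ws_js_is_j\Lambda_j}+2M_{ws_i\Lambda_i},\ M_{ws_is_js_i\Lambda_i}+2M_{ws_is_j\Lambda_j}+M_{w\Lambda_i})$; or (3) $a_{ij}=-2,a_{ji}=-1$ and $M_{ws_js_i\Lambda_i}+M_{ws_i\Lambda_i}+M_{ws_is_j\Lambda_j}=\min(2M_{ws_i\Lambda_i}+M_{ws_js_is_j\Lambda_j},\ 2M_{ws_is_js_i\Lambda_i}+M_{w\Lambda_j},\ M_{ws_is_js_i\Lambda_i}+M_{w\Lambda_i}+M_{ws_is_j\Lambda_j})$, $M_{ws_j\Lambda_j}+2M_{ws_i\Lambda_i}+M_{ws_is_j\Lambda_j}=\min(2M_{ws_is_js_i\Lambda_i}+2M_{w\Lambda_j},\ 2M_{w\Lambda_i}+2M_{ws_is_j\Lambda_j},\ M_{w\Lambda_j}+2M_{ws_i\Lambda_i}+M_{ws_js_is_j\Lambda_j})$.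 **The map $\Phi$.** $\Phi:\mathcal{MV}^\omega\to\widehat{\mathcal{MV}}$, $\Phi(P(\mu_\bullet))=\widehat P\bigl((\mu_{\Theta(\widehat w)})_{\widehat w\in\widehat W}\bigr)$, is a bijection. With $\widehat f_j$ the lowering Kashiwara operator on $\widehat{\mathcal{MV}}$ (characterized by $\widehat\mu'_{\widehat e}=\widehat\mu_{\widehat e}-h_j^\omega$ and $\widehat\mu'_{\widehat w}=\widehat\mu_{\widehat w}$ whenever $\widehat s_j\widehat w<\widehat w$), one has $\widehat f_j\widehat P=\Phi(f_j^\omega P)=\widetilde P(\mu'_\bullet)\cap\mathfrak h^\omega$ for $\widehat P=\Phi(P)$ and $\mu'_\bullet$ the GGMS datum of $f_j^\omega P$. *)

(* Defs.v *)
From HB Require Import structures.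
From mathcomp Require Import all_boot all_order all_algebra.
From mathcomp Require Import zify.
From mathcomp Require Import boolp classical_sets functions reals.

Set Implicit Arguments.
Unset Strict Implicit.
Unset Printing Implicit Defensive.

Import Order.TTheory GRing.Theory Num.Theory.

Local Open Scope classical_set_scope.
Local Open Scope ring_scope.

(* The data attached to a Cartan matrix A of rank r, A i j = <alpha_j, h_i>.
   The real Cartan subalgebra is 'cV[R]_r, a column holding the coordinates in
   the basis of simple coroots; its dual is 'rV[R]_r, a row holding the
   coordinates in the dual basis, that of fundamental weights.  The Weyl group
   is a set of matrices acting on the left on columns.  A family indexed by the
   Weyl group is a function on all matrices, of which only the values on the
   Weyl group are ever used. *)
Section CartanData.
Variables (R : realType) (r : nat) (A : 'M[int]_r).

Implicit Types (i j : 'I_r) (w : 'M[R]_r) (h : 'cV[R]_r).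
Implicit Types (mu : 'M[R]_r -> 'cV[R]_r) (P : set 'cV[R]_r).

Definition pairing (l : 'rV[R]_r) h : R := (l *m h) 0 0.

Definition coroot j : 'cV[R]_r := delta_mx j 0.
Definition fundweight j : 'rV[R]_r := delta_mx 0 j.
Definition simple_root j : 'rV[R]_r := \row_i (A i j)%:~R.

(* h |-> h - <alpha_j, h> h_j *)
Definition refl j : 'M[R]_r := 1%:M - coroot j *m simple_root j.

Definition word_prod (s : seq 'I_r) : 'M[R]_r :=
  \big[mulmx/1%:M]_(i <- s) refl i.

Definition weyl : set 'M[R]_r := [set w | exists s, w = word_prod s].

Definition word_sizes w : set nat :=
  [set k | exists2 s, size s = k & w = word_prod s].

Definition weyl_length w : nat :=
  get [set k | word_sizes w k /\ forall k', word_sizes w k' -> (k <= k')%N].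

Definition is_longest w0 :=
  weyl w0 /\ forall w, weyl w -> (weyl_length w <= weyl_length w0)%N.

(* w s_i > w (right ascent) and s_i w < w (left descent) *)
Definition rasc w i := (weyl_length w < weyl_length (w *m refl i))%N.
Definition ldesc w i := (weyl_length (refl i *m w) < weyl_length w)%N.

(* h >=_w h': membership in the cone spanned by the simple coroots is
   nonnegativity of the coordinates. *)
Definition ge_weyl w h h' :=
  forall j, 0 <= (invmx w *m h - invmx w *m h') j 0.

Definition pseudo_weyl mu :=
  (forall w w', weyl w -> weyl w' -> ge_weyl w (mu w') (mu w)) /\
  (forall w0, is_longest w0 -> mu w0 = 0).

Definition polytope mu : set 'cV[R]_r :=
  [set h | forall w, weyl w -> ge_weyl w h (mu w)].

Definition is_ggms mu P := pseudo_weyl mu /\ P = polytope mu.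

(* M_{w Lambda_i}; the weight w Lambda_i is the form Lambda_i \o w^-1. *)
Definition bz mu w i : R := pairing (fundweight i *m invmx w) (mu w).

Definition integral mu := forall w i, weyl w -> bz mu w i \is a Num.int.

Section Plucker.
Variables (mu : 'M[R]_r -> 'cV[R]_r) (w : 'M[R]_r) (i j : 'I_r).
Let M := bz mu.
Let si := refl i.
Let sj := refl j.

Definition plucker_a2 :=
  M (w *m si) i + M (w *m sj) j =
  Num.min (M w i + M (w *m si *m sj) j) (M (w *m sj *m si) i + M w j).

Definition plucker_b2 :=
  M (w *m sj) j + M (w *m si *m sj) j + M (w *m si) i =
  Num.min (2 * M (w *m si *m sj) j + M w i)
    (Num.min (2 * M w j + M (w *m si *m sj *m si) i)
       (M w j + M (w *m sj *m si *m sj) j + M (w *m si) i)) /\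
  M (w *m sj *m si) i + 2 * M (w *m si *m sj) j + M (w *m si) i =
  Num.min (2 * M w j + 2 * M (w *m si *m sj *m si) i)
    (Num.min (2 * M (w *m sj *m si *m sj) j + 2 * M (w *m si) i)
       (M (w *m si *m sj *m si) i + 2 * M (w *m si *m sj) j + M w i)).

Definition plucker_c2 :=
  M (w *m sj *m si) i + M (w *m si) i + M (w *m si *m sj) j =
  Num.min (2 * M (w *m si) i + M (w *m sj *m si *m sj) j)
    (Num.min (2 * M (w *m si *m sj *m si) i + M w j)
       (M (w *m si *m sj *m si) i + M w i + M (w *m si *m sj) j)) /\
  M (w *m sj) j + 2 * M (w *m si) i + M (w *m si *m sj) j =
  Num.min (2 * M (w *m si *m sj *m si) i + 2 * M w j)
    (Num.min (2 * M w i + 2 * M (w *m si *m sj) j)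
       (M w j + 2 * M (w *m si) i + M (w *m sj *m si *m sj) j)).

End Plucker.

(* For A simply laced, no other rank two relation occurs. *)
Definition mv_datum_simply_laced mu :=
  [/\ pseudo_weyl mu, integral mu &
    forall w i j, weyl w -> i != j -> rasc w i -> rasc w j ->
      A i j = -1 -> A j i = -1 -> plucker_a2 mu w i j].

(* For A with a_ij * a_ji <= 2 for all i != j, e.g. of type C_n. *)
Definition mv_datum_doubly_laced mu :=
  [/\ pseudo_weyl mu, integral mu &
    forall w i j, weyl w -> i != j -> rasc w i -> rasc w j ->
      [\/ A i j = 0 /\ A j i = 0,
          [/\ A i j = -1, A j i = -1 & plucker_a2 mu w i j],
          [/\ A i j = -1, A j i = -2 & plucker_b2 mu w i j] |
          [/\ A i j = -2, A j i = -1 & plucker_c2 mu w i j]]].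

End CartanData.

Section TypeA.
Variables (R : realType) (n : nat).

(* Indices are shifted by one: j in {1, ..., l} is the ordinal j - 1. *)
Definition ell : nat := n.*2.-1.

Definition cartanA : 'M[int]_ell :=
  \matrix_(i, j) (if i == j then 2
                  else if (i.+1 == j) || (j.+1 == i) then -1 else 0).

Definition omegaI (j : 'I_ell) : 'I_ell := rev_ord j.

Definition omegaH (h : 'cV[R]_ell) : 'cV[R]_ell := \col_j h (omegaI j) 0.

(* Conjugation by omegaH. *)
Definition omegaW (w : 'M[R]_ell) : 'M[R]_ell :=
  \matrix_(i, j) w (omegaI i) (omegaI j).

Definition weyl_omega : set 'M[R]_ell :=
  [set w | weyl cartanA w /\ omegaW w = w].

Definition omega_invariant (mu : 'M[R]_ell -> 'cV[R]_ell) :=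
  forall w, weyl cartanA w -> omegaH (mu (omegaW w)) = mu w.

Definition pseudo_weyl_omega mu :=
  pseudo_weyl cartanA mu /\ omega_invariant mu.

Definition MV : set (set 'cV[R]_ell) :=
  [set P | exists2 mu, mv_datum_simply_laced cartanA mu
                     & P = polytope cartanA mu].

Definition MV_omega : set (set 'cV[R]_ell) :=
  [set P | exists mu, [/\ mv_datum_simply_laced cartanA mu,
                          omega_invariant mu & P = polytope cartanA mu]].

(* f_j P = P', as a definite description *)
Definition is_lowering (j : 'I_ell) (P P' : set 'cV[R]_ell) :=
  unique (fun Q => MV Q /\ exists mu mu',
    [/\ is_ggms cartanA mu P, is_ggms cartanA mu' Q,
        mu' 1%:M = mu 1%:M - coroot R j &
        forall w, weyl cartanA w -> ldesc cartanA w j -> mu' w = mu w]) P'.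

Definition tildeP (mu : 'M[R]_ell -> 'cV[R]_ell) : set 'cV[R]_ell :=
  [set h | forall w, weyl_omega w -> ge_weyl w h (mu w)].

End TypeA.

(* The Cartan matrix of type C_n, with a_{n-1,n} = -2 and a_{n,n-1} = -1. *)
Definition cartanC (n : nat) : 'M[int]_n :=
  \matrix_(i, j) (if i == j then 2
                  else if i.+1 == j then (if j.+1 == n then -2 else -1)
                  else if j.+1 == i then -1 else 0).

Lemma leq_ell (n : nat) : (1 < n)%N -> (n <= ell n)%N.
Proof. by case: n => // n _; rewrite /ell doubleS ltnS -addnn leq_addr. Qed.

Lemma ltn_predn (n : nat) : (1 < n)%N -> (n.-1 < n)%N.
Proof. by case: n. Qed.

Section FixedPoint.
Variables (R : realType) (n : nat) (hn : (1 < n)%N).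

Definition emb (j : 'I_n) : 'I_(ell n) := widen_ord (leq_ell hn) j.

(* The index n, in {1, ..., n} and in {1, ..., l}. *)
Definition topI : 'I_n := Ordinal (ltn_predn hn).
Definition midI : 'I_(ell n) := emb topI.

Definition s_omega (j : 'I_n) : 'M[R]_(ell n) :=
  if j == topI then refl R (cartanA n) midI
  else refl R (cartanA n) (emb j) *m refl R (cartanA n) (omegaI (emb j)).

Definition h_omega (j : 'I_n) : 'cV[R]_(ell n) :=
  if j == topI then coroot R midI
  else coroot R (emb j) + coroot R (omegaI (emb j)).

Definition is_lowering_omega (j : 'I_n) (P P' : set 'cV[R]_(ell n)) :=
  if j == topI then is_lowering midI P P'
  else exists2 Q, is_lowering (omegaI (emb j)) P Q & is_lowering (emb j) Q P'.

Definition weyl_omega_plus : set 'M[R]_(ell n) :=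
  [set w | weyl_omega w /\
     (weyl_length (cartanA n) w < weyl_length (cartanA n) (s_omega topI *m w))%N].
Definition weyl_omega_minus : set 'M[R]_(ell n) :=
  [set w | weyl_omega w /\
     (weyl_length (cartanA n) (s_omega topI *m w) < weyl_length (cartanA n) w)%N].

(* The real form of h^omega is 'cV[R]_n, coordinates in the basis h_j^omega;
   this is its inclusion into that of h. *)
Definition incl (x : 'cV[R]_n) : 'cV[R]_(ell n) := \sum_j x j 0 *: h_omega j.

Definition MV_hat : set (set 'cV[R]_n) :=
  [set P | exists2 mu, mv_datum_doubly_laced (cartanC n) mu
                     & P = polytope (cartanC n) mu].

(* Theta is a group isomorphism from the Weyl group of type C_n onto W^omega
   mapping simple reflections to the s_j^omega. *)
Definition is_Theta (Theta : 'M[R]_n -> 'M[R]_(ell n)) :=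
  [/\ forall w w', weyl (cartanC n) w -> weyl (cartanC n) w' ->
        Theta (w *m w') = Theta w *m Theta w',
      set_bij (weyl (cartanC n)) (@weyl_omega R n) Theta &
      forall j, Theta (refl R (cartanC n) j) = s_omega j].

(* The graph of Phi. *)
Definition is_Phi (Theta : 'M[R]_n -> 'M[R]_(ell n))
    (P : set 'cV[R]_(ell n)) (Phat : set 'cV[R]_n) :=
  exists mu muhat,
    [/\ is_ggms (cartanA n) mu P,
        omega_invariant mu,
        forall w, weyl (cartanC n) w -> incl (muhat w) = mu (Theta w) &
        Phat = polytope (cartanC n) muhat].

Definition shift_const (mu : 'M[R]_(ell n) -> 'cV[R]_(ell n)) : R :=
  bz mu 1%:M midI - bz mu (refl R (cartanA n) midI) midI - 1.

Definition sigma (c : R) (h : 'cV[R]_(ell n)) : 'cV[R]_(ell n) :=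
  refl R (cartanA n) midI *m h + c *: coroot R midI.

Definition lowering_conditions (mu mu'' : 'M[R]_(ell n) -> 'cV[R]_(ell n)) :=
  let c := shift_const mu in
  [/\ forall w, weyl_omega_minus w -> mu'' w = mu w,
      mu'' 1%:M = mu 1%:M - h_omega topI,
      forall w, weyl_omega_plus w -> tildeP mu'' (mu w) &
      forall w, weyl_omega_minus w ->
        c <= pairing (simple_root R (cartanA n) midI) (mu w) ->
        tildeP mu'' (sigma c (mu w))].

(* The simple roots of the fixed point algebra are the restrictions of the
   alpha_j, j <= n, to h^omega; their values on the h_i^omega form cartanC. *)
Lemma cartanCE (i j : 'I_n) :
  pairing (simple_root R (cartanA n) (emb j)) (h_omega i) = (cartanC n i j)%:~R.
Proof.
have coE k m : pairing (simple_root R (cartanA n) k) (coroot R m)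
    = (cartanA n m k)%:~R.
  rewrite /pairing mxE (bigD1 m) //= big1 ?addr0 => [|l ne_lm].
    by rewrite !mxE !eqxx mulr1.
  by rewrite !mxE (negPf ne_lm) mulr0.
have jn := ltn_ord j; have i_n := ltn_ord i.
have ellE : ell n = n.*2.-1 by [].
have embE k : (emb k : nat) = k by [].
have omE k : (omegaI (emb k) : nat) = ((n.*2.-1) - k.+1)%N by [].
rewrite /h_omega; case: eqVneq => [->|ne_i].
  rewrite coE; congr (_%:~R); rewrite !mxE -!val_eqE /=.
  by do !case: eqP => ? //=; lia.
have {}ne_i : (i : nat) <> n.-1 by move=> e; case/eqP: ne_i; apply: val_inj.
have -> : pairing (simple_root R (cartanA n) (emb j))
            (coroot R (emb i) + coroot R (omegaI (emb i)))
        = (cartanA n (emb i) (emb j) + cartanA n (omegaI (emb i)) (emb j))%:~R.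
  by rewrite /pairing mulmxDr mxE -!/(pairing _ _) !coE intrD.
congr (_%:~R); rewrite !mxE -!val_eqE /= ?embE ?omE.
by do !case: eqP => ? //=; lia.
Qed.

End FixedPoint.

(* Main.v *)
Require Import Defs.
From mathcomp Require Import all_boot all_order all_algebra all_fingroup.
From mathcomp Require Import zify lra.
From mathcomp Require Import boolp classical_sets functions reals.

(** Write m = 2n and let M, M' be the collections of numbers attached to P and
    to its lowering P'.  A chamber weight of type A is a proper nonempty subset
    T of {1, ..., m}; the simple reflection s_n exchanges p = n and q = n + 1,
    and h_n takes on T the value 1, 0 or -1 according to which of p, q lie in T.

    The crux is the closed formula (lowered_bz)
      M'_T = min (M_T, M_(s_n T) + c)  if T contains p but not q,
      M'_T = M_T                       otherwise.
    In the second case T is w Lambda_i for some w with s_n w < w, and at such w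
    the vertices of P and P' agree.
    For the other T, put d(S) = M_(S + p) - M_(S + q), and d' similarly, for S
    avoiding p and q.  The tropical Pluecker relations say
      d(S)     = min (K, d(S + a))   for a < p,
      d(S + b) = min (d(S), K')      for b > q,
    where K and K' only involve values of M that lowering preserves.  So the
    identity d'(S) = min (d(S), c) passes from S + a to S and from S to S + b.
    It holds for S = {1, ..., p - 1}, because the vertex at e moves by -h_n and
    c is d(S) - 1; from this S every other one is reached by removing elements
    below p and adding elements above q.

    Given the formula, everything else is bookkeeping with the pairings of a
    chamber weight and s_n.  The formula commutes with the diagram automorphism
    (lowered_omega); M' <= M shows that the vertices of P lie in the new polytope
    (lowered_contains), and the pairing of T with the image under sigma of a
    vertex reduces to the pairing of s_n T with that vertex
    (lowered_contains_sigma).  For minimality (lowered_minimal), let mu'' satisfy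
    the lowering conditions and let T, containing p but not q, be produced by
    v in W^omega.  As mu_v lies in the polytope of mu'', M''_T <= M_T.  Put
    u = s_n v.  If alpha_n (mu_u) >= c, then sigma (mu_u) lies in that polytope
    too, so M''_T <= M_(s_n T) + c; otherwise mu_u, as a point of P, shows that
    M_T < M_(s_n T) + c.  For the other T, M''_T = M_T = M'_T because the
    vertices at the w in W^omega with s_n w < w are prescribed.  Hence M'' <= M'
    on the chamber weights that define the polytopes, which is the inclusion.

    The abstract Weyl group is handled through explicit permutation matrices
    (perm_weyl), whose lengths are numbers of inversions (weyl_length_perm). *)

Set Implicit Arguments.
Unset Strict Implicit.
Unset Printing Implicit Defensive.

Import Order.TTheory GRing.Theory Num.Theory.

Local Open Scope ring_scope.

(** * Permutations and inversions *)

Section SymmetricGroup.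
Variable r : nat.
Implicit Types (s : 'S_r.+1) (i j : 'I_r) (a b x y : 'I_r.+1).

Definition lo j : 'I_r.+1 := widen_ord (leqnSn r) j.
Definition hi j : 'I_r.+1 := lift ord0 j.
Definition adj j : 'S_r.+1 := tperm (lo j) (hi j).

Lemma val_lo j : lo j = j :> nat. Proof. by []. Qed.
Lemma val_hi j : hi j = j.+1 :> nat. Proof. by []. Qed.

Lemma val_adj j x :
  adj j x = (if x == j :> nat then j.+1 else if x == j.+1 :> nat then j : nat else x) :> nat.
Proof.
rewrite /adj; case: tpermP => [->|->|/eqP + /eqP].
- by rewrite val_hi val_lo eqxx.
- by rewrite val_lo val_hi gtn_eqF // eqxx.
- by rewrite -!val_eqE /= /bump leq0n add1n => /negPf-> /negPf->.
Qed.

Definition inversions s : {set 'I_r.+1 * 'I_r.+1} :=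
  [set x : 'I_r.+1 * 'I_r.+1 | (x.1 < x.2)%N && (s x.2 < s x.1)%N].
Definition inversion_count s := #|inversions s|.

(** An adjacent transposition only reverses the order of the two points it
    exchanges, so it changes the number of inversions by one. *)
Lemma adj_mono j a b :
  (a < b)%N -> (a, b) != (lo j, hi j) -> (adj j a < adj j b)%N.
Proof.
by rewrite xpair_eqE -!val_eqE /= /bump leq0n add1n !val_adj => + /eqP; do !case: eqP => //=; lia.
Qed.

Lemma adjK j : involutive (adj j).
Proof. exact: tpermK. Qed.

Lemma inversion_count_adj j s :
  (s (lo j) < s (hi j))%N -> inversion_count (adj j * s)%g = (inversion_count s).+1.
Proof.
move=> s_lt; rewrite /inversion_count (cardsD1 (lo j, hi j) (inversions (adj j * s)%g)).
have -> : (lo j, hi j) \in inversions (adj j * s)%g.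
  by rewrite inE /= !permM tpermL tpermR s_lt andbT.
rewrite add1n; congr _.+1.
pose f (x : 'I_r.+1 * 'I_r.+1) := (adj j x.1, adj j x.2).
rewrite -(card_imset (mem (inversions s)) (f := f)).
  apply: eq_card => -[a b]; rewrite !inE /= !permM; apply/idP/imsetP => [|[[a' b']]].
    case/and3P=> ne_ab lt_ab inv_ab; exists (adj j a, adj j b); rewrite /f /= ?adjK //.
    by rewrite inE /= inv_ab adj_mono.
  rewrite inE /= => /andP[lt_ab inv_ab] [-> ->]; rewrite !adjK inv_ab andbT.
  have ne_ab : (a', b') != (lo j, hi j).
    by apply/eqP=> -[ea eb]; move: inv_ab; rewrite ea eb ltnNge ltnW.
  rewrite adj_mono // andbT; apply/eqP=> -[ea eb].
  have {ea} ea : a' = hi j by rewrite -(adjK j a') ea tpermL.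
  have {eb} eb : b' = lo j by rewrite -(adjK j b') eb tpermR.
  by move: lt_ab; rewrite ea eb val_lo val_hi ltnNge leqnSn.
by move=> [a b] [a' b'] /= [] /perm_inj-> /perm_inj->.
Qed.

Lemma inversion_count_adj_desc j s :
  (s (hi j) < s (lo j))%N -> inversion_count s = (inversion_count (adj j * s)%g).+1.
Proof.
move=> s_j; rewrite -(@inversion_count_adj j); first by rewrite mulgA tperm2 mul1g.
by rewrite !permM tpermL tpermR.
Qed.

Lemma inversion_countV s : inversion_count s^-1%g = inversion_count s.
Proof.
pose f (x : 'I_r.+1 * 'I_r.+1) := (s x.2, s x.1).
rewrite /inversion_count -(card_imset (mem (inversions s)) (f := f)).
  apply: eq_card => -[a b]; rewrite !inE /=; apply/idP/imsetP => [|[[a' b']]].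
    case/andP=> lt_ab inv_ab; exists (s^-1%g b, s^-1%g a); rewrite /f /= ?permKV //.
    by rewrite inE /= !permKV inv_ab lt_ab.
  by rewrite inE /= => /andP[lt_ab inv_ab] [-> ->]; rewrite !permK lt_ab inv_ab.
by move=> [a b] [a' b'] /= [] /perm_inj-> /perm_inj->.
Qed.

Lemma inversion_count_adjr j s :
  (s^-1%g (lo j) < s^-1%g (hi j))%N -> inversion_count (s * adj j)%g = (inversion_count s).+1.
Proof.
by move=> lt_s; rewrite -inversion_countV invMg tpermV inversion_count_adj // inversion_countV.
Qed.

Lemma inversion_count_adjr_desc j s :
  (s^-1%g (hi j) < s^-1%g (lo j))%N -> inversion_count s = (inversion_count (s * adj j)%g).+1.
Proof.
move=> lt_s; rewrite -[LHS]inversion_countV (inversion_count_adj_desc lt_s).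
by rewrite -inversion_countV invMg invgK tpermV.
Qed.

Lemma perm_adj_neq j s : s (lo j) <> s (hi j) :> nat.
Proof. by move/val_inj/perm_inj/(congr1 val); rewrite /= /bump; lia. Qed.

(** It makes the descent induction of perm_weyl_reduced end at the identity. *)
Lemma increasing_id s : (forall j, s (lo j) < s (hi j))%N -> s = 1%g.
Proof.
move=> s_inc.
have s_ge k a : (a + k = r)%N -> (s a + k <= r)%N.
  elim: k a => [|k IHk] a ak; first by rewrite addn0 -ltnS.
  have lt_ar : (a < r)%N by lia.
  have := s_inc (Ordinal lt_ar); have /= := IHk (hi (Ordinal lt_ar)).
  have -> : lo (Ordinal lt_ar) = a by apply: val_inj.
  by rewrite /bump; lia.
have s_le k a : a = k :> nat -> (k <= s a)%N.
  elim: k a => [|k IHk] a ak //.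
  have lt_kr : (k < r)%N by have := ltn_ord a; lia.
  have := s_inc (Ordinal lt_kr); have /= := IHk (lo (Ordinal lt_kr)) erefl.
  have -> : hi (Ordinal lt_kr) = a by apply: val_inj; rewrite /= ak.
  by lia.
apply/permP=> a; apply: val_inj; rewrite perm1 /=.
have := s_le a a erefl; have := @s_ge (r - a)%N a; have := ltn_ord a.
by lia.
Qed.

Lemma inversion_count1 : inversion_count 1%g = 0%N.
Proof.
by apply/eqP; rewrite cards_eq0; apply/eqP/setP=> -[a b]; rewrite !inE !perm1 /=; lia.
Qed.

(** It yields Weyl group elements whose chamber weights are prescribed sets. *)
Lemma perm_listing (L : seq 'I_r.+1) : uniq L ->
  exists s, forall x0 a, (a < size L)%N -> s a = nth x0 L a.
Proof.
move=> uL; pose L' := L ++ [seq x <- enum 'I_r.+1 | x \notin L].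
have uL' : uniq L'.
  rewrite cat_uniq uL filter_uniq ?enum_uniq ?andbT //=.
  by apply/hasPn=> x; rewrite mem_filter => /andP[].
have sL' : size L' = r.+1.
  rewrite -[RHS]card_ord cardE; apply: perm_size; apply: uniq_perm; rewrite ?enum_uniq //.
  by move=> x; rewrite mem_cat mem_filter mem_enum inE /= andbT orbN.
have nth_inj : injective (fun a : 'I_r.+1 => nth ord0 L' a).
  move=> a b /eqP; rewrite nth_uniq ?sL' ?ltn_ord // => /eqP; exact: val_inj.
exists (perm nth_inj) => x0 a aL; rewrite permE nth_cat aL.
exact: set_nth_default.
Qed.

Lemma mem_listing s (L : seq 'I_r.+1) k x : uniq L ->
  (forall x0 (a : 'I_r.+1), (a < size L)%N -> s a = nth x0 L a) -> (k <= size L)%N ->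
  (x \in take k L) = (s^-1%g x < k)%N.
Proof.
move=> uL sL le_kL; apply/idP/idP => [x_L|lt_xk].
  have lt_k : (index x (take k L) < k)%N.
    by rewrite -{2}(size_takel le_kL) index_mem.
  have Lx : nth x L (index x (take k L)) = x by rewrite -(nth_take x lt_k) nth_index.
  have lt_r : (index x (take k L) < r.+1)%N.
    apply: leq_trans lt_k (leq_trans le_kL _).
    by rewrite -(card_uniqP uL) -[X in (_ <= X)%N]card_ord max_card.
  rewrite -[X in s^-1%g X]Lx -(sL x (Ordinal lt_r)) ?permK //=.
  exact: leq_trans le_kL.
have := sL x (s^-1%g x); rewrite permKV => -> //; last exact: leq_trans le_kL.
by rewrite -(nth_take x lt_xk) mem_nth // size_takel.
Qed.

End SymmetricGroup.

(** * The Weyl group of type A as permutation matrices *)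

Lemma indicator_sub_eq1 (R : numDomainType) (b1 b2 : bool) :
  (b1%:R - b2%:R == 1 :> R) = b1 && ~~ b2.
Proof.
case: b1 b2 => [] [] /=; rewrite ?subrr ?subr0 ?eqxx // 1?eq_sym ?oner_eq0 //.
by rewrite sub0r -subr_eq0 opprK -mulr2n pnatr_eq0.
Qed.

Lemma indicator_sub_eqN1 (R : numDomainType) (b1 b2 : bool) :
  (b1%:R - b2%:R == -1 :> R) = ~~ b1 && b2.
Proof. by rewrite -eqr_opp opprK opprB indicator_sub_eq1 andbC. Qed.

Lemma reflE (R : realType) r (A : 'M[int]_r) j i k :
  refl R A j i k = (i == k)%:R - (i == j)%:R * (A k j)%:~R.
Proof. by rewrite !mxE big_ord1 !mxE eqxx andbT. Qed.

Section PermutationMatrices.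
Variables (R : realType) (r : nat).
Implicit Types (s t : 'S_r.+1) (T : {set 'I_r.+1}) (i j : 'I_r).

(** The form sending h to the sum over T of its coordinates in R^m, where the
    coroot h_j is e_j - e_(j+1). *)
Definition set_weight T : 'rV[R]_r := \row_j ((lo j \in T)%:R - (hi j \in T)%:R).

(** The permutation action on the sum-zero part of R^m in the basis of simple
    coroots: entry (i, j) adds up the coordinates of s (e_j - e_(j+1)) of index
    at most i. *)
Definition perm_weyl s : 'M[R]_r :=
  \matrix_(i, j) ((s (lo j) <= i)%:R - (s (hi j) <= i)%:R).

(** Summation by parts: only the steps k >= x of the telescope survive. *)
Lemma sum_differences_below (f : 'I_r.+1 -> R) (x : 'I_r.+1) :
  \sum_j (f (lo j) - f (hi j)) * (x <= j)%:R = f x - f ord_max.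
Proof.
pose g k := f (inord k).
transitivity (\sum_(0 <= k < r) (g k - g k.+1) * (x <= k)%:R).
  rewrite big_mkord; apply: eq_bigr => j _; rewrite /g.
  by congr ((f _ - f _) * _); apply: val_inj; rewrite /= inordK // ltnS // ltnW.
have le_xr : (x <= r)%N by rewrite -ltnS.
rewrite (@big_cat_nat _ _ _ x) //=.
rewrite big_nat big1 ?add0r => [|k /andP[_ lt_kx]]; last by rewrite leqNgt lt_kx mulr0.
rewrite big_nat (eq_bigr (fun k => (- g k.+1) - (- g k))); last first.
  by move=> k /andP[-> _]; rewrite mulr1 opprK addrC.
rewrite -big_nat (telescope_sumr (fun k => - g k)) // opprK addrC /g.
by congr (f _ - f _); apply: val_inj; rewrite /= inordK.
Qed.

Lemma set_weight_mul T s : set_weight T *m perm_weyl s = set_weight [set a | s a \in T].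
Proof.
apply/rowP=> j; rewrite !mxE.
transitivity (\sum_k (((lo k \in T)%:R - (hi k \in T)%:R) * (s (lo j) <= k)%:R
    - ((lo k \in T)%:R - (hi k \in T)%:R) * (s (hi j) <= k)%:R) : R).
  by apply: eq_bigr => k _; rewrite !mxE mulrBr.
rewrite sumrB !(sum_differences_below (fun x => (x \in T)%:R)) !inE.
by rewrite opprB addrA subrK.
Qed.

Lemma row_perm_weyl i s : row i (perm_weyl s) = set_weight [set a | (s a <= i)%N].
Proof. by apply/rowP=> j; rewrite !mxE !inE. Qed.

Lemma perm_weylM s t : perm_weyl s *m perm_weyl t = perm_weyl (t * s)%g.
Proof.
apply/row_matrixP=> i; rewrite row_mul !row_perm_weyl set_weight_mul.
by congr set_weight; apply/setP=> a; rewrite !inE permM.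
Qed.

Lemma perm_weyl1 : perm_weyl 1%g = 1%:M.
Proof.
apply/matrixP=> i j; rewrite !mxE !perm1 -!val_eqE /= /bump leq0n add1n.
by case: ltngtP => lt_ij; rewrite ?subr0 ?subrr.
Qed.

Lemma perm_weyl_unit s : perm_weyl s \in unitmx.
Proof.
have inv_s : perm_weyl s *m perm_weyl s^-1%g = 1%:M by rewrite perm_weylM mulVg perm_weyl1.
by have [] := mulmx1_unit inv_s.
Qed.

Lemma perm_weylV s : invmx (perm_weyl s) = perm_weyl s^-1%g.
Proof.
by rewrite -[RHS](mulKmx (perm_weyl_unit s)) perm_weylM mulVg perm_weyl1 mulmx1.
Qed.

Lemma perm_weyl_inj : injective perm_weyl.
Proof.
suff perm_weyl_eq1 s : perm_weyl s = 1%:M -> s = 1%g.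
  move=> s t eq_st; apply/eqP; rewrite -(can_eq (mulgK t^-1%g)) mulgV; apply/eqP.
  apply: perm_weyl_eq1; rewrite -perm_weylM -perm_weylV eq_st.
  by rewrite mulVmx ?perm_weyl_unit.
move=> w1; apply: increasing_id => j; move/matrixP/(_ j j): w1; rewrite !mxE eqxx.
by move/eqP; rewrite indicator_sub_eq1 -ltnNge => /andP[le_lo]; apply: leq_ltn_trans.
Qed.

(** The chamber weight w Lambda_i is the set of the first i + 1 entries of s in
    one-line notation. *)
Lemma chamber_row i s :
  fundweight R i *m invmx (perm_weyl s) = set_weight [set a | (s^-1%g a <= i)%N].
Proof. by rewrite perm_weylV -rowE row_perm_weyl. Qed.

End PermutationMatrices.

Section WeylGroup.
Variables (R : realType) (n : nat).
Local Notation r := (ell n).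
Local Notation C := (cartanA n).
Implicit Types (s t : 'S_r.+1) (T : {set 'I_r.+1}) (i j : 'I_r) (w : 'M[R]_r).

Lemma perm_weyl_adj j : perm_weyl R (adj j) = refl R C j.
Proof.
apply/matrixP=> i k; rewrite reflE !mxE; set D : int := if k == j then 2 else _.
(* Both entries are images of integers, and the equality holds in int. *)
have -> : (i == k)%:R - (i == j)%:R * D%:~R = ((i == k)%:Z - (i == j)%:Z * D)%:~R :> R.
  by rewrite intrB intrM.
rewrite [LHS](_ : _ = ((adj j (lo k) <= i)%:Z - (adj j (hi k) <= i)%:Z)%:~R); last first.
  by rewrite intrB.
congr _%:~R; rewrite {}/D !val_adj -!val_eqE /= /bump leq0n add1n.
by do !case: eqP => ? //=; lia.
Qed.

Lemma reflK j : refl R C j *m refl R C j = 1%:M.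
Proof. by rewrite -perm_weyl_adj perm_weylM tperm2 perm_weyl1. Qed.

Lemma refl_perm_weyl j s : refl R C j *m perm_weyl R s = perm_weyl R (s * adj j)%g.
Proof. by rewrite -perm_weyl_adj perm_weylM. Qed.

Lemma perm_weyl_refl j s : perm_weyl R s *m refl R C j = perm_weyl R (adj j * s)%g.
Proof. by rewrite -perm_weyl_adj perm_weylM. Qed.

(** Each letter changes the number of inversions by one, so a word is at least
    as long as the permutation it represents has inversions. *)
Lemma word_prod_perm (l : seq 'I_r) :
  exists2 s, word_prod R C l = perm_weyl R s & (inversion_count s <= size l)%N.
Proof.
rewrite /word_prod; elim: l => [|j l [s ws inv_s]].
  by exists 1%g; rewrite ?big_nil ?perm_weyl1 ?inversion_count1.
exists (s * adj j)%g; first by rewrite big_cons ws refl_perm_weyl.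
rewrite [size _]/=; case: (ltngtP (s^-1%g (lo j)) (s^-1%g (hi j))) => [lt_s|gt_s|eq_s].
- by rewrite inversion_count_adjr.
- by rewrite (inversion_count_adjr_desc gt_s) in inv_s; lia.
- by case: (perm_adj_neq eq_s).
Qed.

Lemma perm_weyl_reduced s :
  exists2 l, size l = inversion_count s & word_prod R C l = perm_weyl R s.
Proof.
have [k] := ubnP (inversion_count s); elim: k s => // k IHk s lt_sk.
have [/forallP inc|] := boolP [forall j, (s^-1%g (lo j) < s^-1%g (hi j))%N].
  have -> : s = 1%g by apply: invg_inj; rewrite invg1 (increasing_id inc).
  by exists [::]; rewrite ?inversion_count1 // /word_prod big_nil perm_weyl1.
rewrite negb_forall => /existsP[j]; rewrite -leqNgt leq_eqVlt => /orP[/eqP eq_s|gt_s].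
  by case: (perm_adj_neq (esym eq_s)).
have inv_s := inversion_count_adjr_desc gt_s.
case: (IHk (s * adj j)%g) => [|l sz_l wl]; first by lia.
exists (j :: l); first by rewrite /= sz_l inv_s.
rewrite /word_prod big_cons -/(word_prod R C l) wl refl_perm_weyl.
by rewrite -mulgA tperm2 mulg1.
Qed.

Lemma weyl_perm_weyl s : weyl C (perm_weyl R s).
Proof. by have [l _ <-] := perm_weyl_reduced s; exists l. Qed.

Lemma weylP w : weyl C w -> exists s, w = perm_weyl R s.
Proof. by case=> l ->; have [s -> _] := word_prod_perm l; exists s. Qed.

Lemma weyl_length_perm s : weyl_length C (perm_weyl R s) = inversion_count s.
Proof.
(* The length is a definite description, so both it and the number of inversions
   are least among the sizes of words for s. *)
have min_inv : word_sizes C (perm_weyl R s) (inversion_count s) /\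
    forall k, word_sizes C (perm_weyl R s) k -> (inversion_count s <= k)%N.
  split=> [|k [l <- wl]]; first by have [l] := perm_weyl_reduced s; exists l.
  by have [t wt_l] := word_prod_perm l; rewrite wt_l in wl; rewrite (perm_weyl_inj wl).
have [size_w min_w] : word_sizes C (perm_weyl R s) (weyl_length C (perm_weyl R s)) /\
    forall k, word_sizes C (perm_weyl R s) k -> (weyl_length C (perm_weyl R s) <= k)%N.
  pose Q : set nat := fun k => word_sizes C (perm_weyl R s) k /\
    forall k', word_sizes C (perm_weyl R s) k' -> (k <= k')%N.
  exact: (getPex (ex_intro Q _ min_inv)).
by apply/eqP; rewrite eqn_leq min_w ?min_inv.2 //; case: min_inv.
Qed.

Lemma rasc_perm_weyl i s : (s (lo i) < s (hi i))%N -> rasc C (perm_weyl R s) i.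
Proof. by move=> lt_s; rewrite /rasc perm_weyl_refl !weyl_length_perm inversion_count_adj. Qed.

Lemma length_refl_up j s : (s^-1%g (lo j) < s^-1%g (hi j))%N ->
  (weyl_length C (perm_weyl R s) < weyl_length C (refl R C j *m perm_weyl R s))%N.
Proof.
by move=> lt_s; rewrite refl_perm_weyl !weyl_length_perm inversion_count_adjr.
Qed.

Lemma length_refl_down j s : (s^-1%g (hi j) < s^-1%g (lo j))%N ->
  (weyl_length C (refl R C j *m perm_weyl R s) < weyl_length C (perm_weyl R s))%N.
Proof.
by move=> lt_s; rewrite refl_perm_weyl !weyl_length_perm (inversion_count_adjr_desc lt_s).
Qed.

(** The value of w Lambda_i on h_j compares the positions of j and j + 1 in the
    one-line notation of w, and so does the order between w and s_j w; a nonzero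
    value therefore decides which of the two elements is longer. *)
Lemma chamber_values w i j : weyl C w ->
  let x := (fundweight R i *m invmx w) 0 j in
  [/\ x \in [:: -1; 0; 1],
      x = 1 -> (weyl_length C w < weyl_length C (refl R C j *m w))%N,
      x = -1 -> ldesc C w j &
      ldesc C w j \/ ldesc C (refl R C j *m w) j].
Proof.
case/weylP=> s ->; rewrite chamber_row !mxE !inE /ldesc.
set a := s^-1%g (lo j); set b := s^-1%g (hi j).
split.
- by do 2!case: leqP => _; rewrite !inE ?subrr ?sub0r ?subr0 eqxx ?orbT.
- move/eqP; rewrite indicator_sub_eq1 -ltnNge => /andP[le_ai lt_ib].
  by apply: length_refl_up; apply: leq_ltn_trans lt_ib.
- move/eqP; rewrite indicator_sub_eqN1 -ltnNge => /andP[lt_ia le_bi].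
  by apply: length_refl_down; apply: leq_ltn_trans lt_ia.
- rewrite mulmxA reflK mul1mx.
  case: (ltngtP a b) => [lt_ab|gt_ab|/perm_adj_neq //].
    by right; apply: length_refl_up.
  by left; apply: length_refl_down.
Qed.

Lemma weyl_unit w : weyl C w -> w \in unitmx.
Proof. by case/weylP=> s ->; apply: perm_weyl_unit. Qed.

Lemma weyl_refl j w : weyl C w -> weyl C (refl R C j *m w).
Proof. by case/weylP=> s ->; rewrite refl_perm_weyl; apply: weyl_perm_weyl. Qed.

Lemma chamber_refl j w i : weyl C w ->
  fundweight R i *m invmx (refl R C j *m w) = fundweight R i *m invmx w *m refl R C j.
Proof.
move=> ww; have wu := weyl_unit ww; have wu' := weyl_unit (weyl_refl j ww).
rewrite -mulmxA; congr (_ *m _).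
rewrite -[RHS]mulmx1 -(mulmxV wu') mulmxA -(mulmxA (invmx w)).
by rewrite (mulmxA (refl _ _ _)) reflK mul1mx mulVmx // mul1mx.
Qed.

Lemma mul_refl j (l : 'rV[R]_r) : l *m refl R C j = l - l 0 j *: simple_root R C j.
Proof.
rewrite mulmxBr mulmx1; congr (_ - _); rewrite mulmxA -colE.
by apply/rowP=> k; rewrite !mxE big_ord1 !mxE.
Qed.

End WeylGroup.

(** * Pairings and Berenstein-Zelevinsky data *)

Section Pairing.
Variables (R : realType) (r : nat).
Implicit Types (l : 'rV[R]_r) (h : 'cV[R]_r) (w : 'M[R]_r).

Lemma pairingDr l h h' : pairing l (h + h') = pairing l h + pairing l h'.
Proof. by rewrite /pairing mulmxDr mxE. Qed.
Lemma pairingBr l h h' : pairing l (h - h') = pairing l h - pairing l h'.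
Proof. by rewrite /pairing mulmxBr !mxE. Qed.
Lemma pairingBl l l' h : pairing (l - l') h = pairing l h - pairing l' h.
Proof. by rewrite /pairing mulmxBl !mxE. Qed.
Lemma pairingZr l a h : pairing l (a *: h) = a * pairing l h.
Proof. by rewrite /pairing -scalemxAr mxE. Qed.

Lemma pairing_coroot l j : pairing l (coroot R j) = l 0 j.
Proof. by rewrite /pairing -colE mxE. Qed.
Lemma pairing_mul l w h : pairing l (w *m h) = pairing (l *m w) h.
Proof. by rewrite /pairing mulmxA. Qed.

Lemma coordE w h i : (invmx w *m h) i 0 = pairing (fundweight R i *m invmx w) h.
Proof. by rewrite -pairing_mul /pairing -rowE [RHS]mxE. Qed.

Lemma ge_weylE w h h' : ge_weyl w h h' <->
  forall i, pairing (fundweight R i *m invmx w) h' <= pairing (fundweight R i *m invmx w) h.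
Proof.
have coordB i : (invmx w *m h - invmx w *m h') i 0
    = pairing (fundweight R i *m invmx w) h - pairing (fundweight R i *m invmx w) h'.
  by rewrite -!coordE [LHS]mxE [in LHS](mxE _ (- _)).
by split=> ge_w i; move: (ge_w i); rewrite coordB subr_ge0.
Qed.
End Pairing.

Section Datum.
Variables (R : realType) (n : nat).
Local Notation r := (ell n).
Local Notation C := (cartanA n).
Local Notation chw w i := (fundweight R i *m invmx w).
Implicit Types (s t : 'S_r.+1) (S T : {set 'I_r.+1}) (i j : 'I_r) (w : 'M[R]_r).
Implicit Types (mu : 'M[R]_r -> 'cV[R]_r).

(** The pairings with the w Lambda_i are the coordinates of a vertex in the basis
    of the w h_i. *)
Lemma vertex_inj mu nu w : w \in unitmx -> (forall i, bz mu w i = bz nu w i) -> mu w = nu w.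
Proof.
move=> w_unit eq_bz; rewrite -[LHS](mulKVmx w_unit) -[RHS](mulKVmx w_unit).
by congr (_ *m _); apply/colP=> i; rewrite !coordE; apply: eq_bz.
Qed.

Lemma bz_le mu w w' i : pseudo_weyl C mu -> weyl C w -> weyl C w' ->
  bz mu w i <= pairing (chw w i) (mu w').
Proof. by move=> [+ _] ww ww'; move=> /(_ w w' ww ww')/ge_weylE; apply. Qed.

Lemma polytopeE mu h : polytope C mu h <->
  forall w i, weyl C w -> bz mu w i <= pairing (chw w i) h.
Proof.
split=> [Ph w i ww|Ph w ww]; last by apply/ge_weylE=> i; apply: Ph.
by move: (Ph w ww) => /ge_weylE; apply.
Qed.

Lemma vertex_polytope mu w : pseudo_weyl C mu -> weyl C w -> polytope C mu (mu w).
Proof. by move=> pw ww; apply/polytopeE=> w' i ww'; apply: bz_le. Qed.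

Lemma ggms_unique mu nu P w : is_ggms C mu P -> is_ggms C nu P -> weyl C w -> mu w = nu w.
Proof.
move=> [pmu Pmu] [pnu Pnu] ww; apply: (vertex_inj (weyl_unit ww)) => i.
have := vertex_polytope pmu ww; rewrite -Pmu Pnu => /polytopeE/(_ w i ww) le_nu.
have := vertex_polytope pnu ww; rewrite -Pnu Pmu => /polytopeE/(_ w i ww) le_mu.
by apply/le_anti/andP; split.
Qed.

(** The minimum of w Lambda_i over the vertices is attained at mu_w, so M depends
    on the weight only. *)
Lemma bz_chamber mu w w' i i' : pseudo_weyl C mu -> weyl C w -> weyl C w' ->
  chw w i = chw w' i' -> bz mu w i = bz mu w' i'.
Proof.
move=> pw ww ww' eq_ch; apply/le_anti/andP; split.
  by apply: (le_trans (bz_le i pw ww ww')); rewrite eq_ch.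
by apply: (le_trans (bz_le i' pw ww' ww)); rewrite -eq_ch.
Qed.

(** M_T for a set T: the minimum over the vertices of the form attached to T.
    This avoids choosing an element w and an index i that produce T. *)
Definition support_value mu T : R :=
  \big[Num.min/pairing (set_weight R T) (mu 1%:M)]_s pairing (set_weight R T) (mu (perm_weyl R s)).

Lemma support_bz mu s i T : pseudo_weyl C mu -> T = [set a | (s^-1%g a <= i)%N] ->
  support_value mu T = bz mu (perm_weyl R s) i.
Proof.
move=> pw ->; rewrite /support_value -chamber_row; apply/le_anti/andP; split.
  exact: (bigmin_le _ s).
apply: le_bigmin => [|t _]; last by apply: bz_le pw _ _; apply: weyl_perm_weyl.
by rewrite -(perm_weyl1 R); apply: bz_le pw _ _; apply: weyl_perm_weyl.
Qed.

Lemma chamber_set T : T != finset.set0 -> T != [set: 'I_r.+1]%SET ->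
  exists s i, T = [set a | (s^-1%g a <= i)%N].
Proof.
move=> T0 T1; have [s sL] := perm_listing (enum_uniq T).
have gt0 : (0 < #|T|)%N by rewrite card_gt0.
have lt_r : (#|T|.-1 < r)%N.
  have : (#|T| < r.+1)%N.
    by rewrite -[X in (_ < X)%N]card_ord -cardsT proper_card // properT.
  by lia.
exists s, (Ordinal lt_r); apply/setP=> x; rewrite inE /= -ltnS prednK //.
by rewrite -(mem_listing x (enum_uniq T) sL) -?cardE // cardE take_size mem_enum.
Qed.

(** Closes an equality between explicit sets by comparing positions in the
    one-line notation of the permutation at hand. *)
Ltac initial_sets memS eqa eqb eqc :=
  let x := fresh "x" in
  apply/setP=> x; rewrite !inE !(invMg, tpermV, permM, val_adj, memS, eqa, eqb, eqc) /=;
  move: (nat_of_ord _) #|_|; clear=> x k;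
  repeat match goal with |- context [if ?b then _ else _] =>
    lazymatch b with context [if _ then _ else _] => fail | _ => case: (boolP b) => ? end end;
  lia.

(** The relation at the element w whose one-line notation starts with S, a, b, c
    is the three-term relation of S, a, b, c. *)
Lemma support_plucker mu S (a b c : 'I_r.+1) : mv_datum_simply_laced C mu ->
  (a < b)%N -> (b < c)%N -> a \notin S -> b \notin S -> c \notin S ->
  support_value mu (b |: S) + support_value mu (a |: (c |: S)) =
  Num.min (support_value mu (a |: S) + support_value mu (b |: (c |: S)))
          (support_value mu (c |: S) + support_value mu (a |: (b |: S))).
Proof.
case=> pw _ tp lt_ab lt_bc aS bS cS; pose L := enum S ++ [:: a; b; c].
have uL : uniq L.
  rewrite cat_uniq enum_uniq /= !inE !mem_enum (negPf aS) (negPf bS) (negPf cS) /= andbT.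
  by rewrite -!val_eqE /=; lia.
have [s sL] := perm_listing uL.
have sz_L : size L = #|S|.+3 by rewrite size_cat -cardE addnC.
have lt_r : (#|S|.+1 < r)%N.
  by rewrite -ltnS -sz_L -(card_uniqP uL) -[X in (_ <= X)%N]card_ord max_card.
have lt_r' : (#|S| < r)%N by apply: ltn_trans lt_r.
pose i := Ordinal lt_r'; pose j := Ordinal lt_r.
have memS x : (x \in S) = (s^-1%g x < #|S|)%N.
  by rewrite -(mem_listing x uL sL) ?sz_L 1?ltnW // 1?ltnW // take_size_cat -?cardE // mem_enum.
(* The entries a, b, c follow S, at the positions #|S|, #|S| + 1, #|S| + 2. *)
have nthL k y : (k < 3)%N -> nth ord0 [:: a; b; c] k = y ->
    forall x, (x == y) = (s^-1%g x == #|S| + k :> nat)%N.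
  move=> lt_k3 nth_k x; rewrite -(inj_eq (@perm_inj _ s^-1%g)) -val_eqE /=.
  suff -> : s^-1%g y = (#|S| + k)%N :> nat by [].
  have lt_kr : (#|S| + k < r.+1)%N by lia.
  have := sL ord0 (Ordinal lt_kr); rewrite sz_L /= -addn3 ltn_add2l => /(_ lt_k3).
  rewrite nth_cat -cardE ltnNge leq_addr /= addKn nth_k => <-.
  by rewrite permK.
have eqa := nthL 0%N a isT erefl; have eqb := nthL 1%N b isT erefl.
have eqc := nthL 2%N c isT erefl.
have sa (x : 'I_r.+1) : x = #|S| :> nat -> s x = a.
  by move=> xS; apply/eqP; rewrite eqa permK addn0 xS.
have sb (x : 'I_r.+1) : x = #|S|.+1 :> nat -> s x = b.
  by move=> xS; apply/eqP; rewrite eqb permK addn1 xS.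
have sc (x : 'I_r.+1) : x = #|S|.+2 :> nat -> s x = c.
  by move=> xS; apply/eqP; rewrite eqc permK addn2 xS.
have ij : i != j by rewrite -val_eqE /= ltn_eqF.
have asc_i : rasc C (perm_weyl R s) i by apply: rasc_perm_weyl; rewrite (sa (lo i)) // (sb (hi i)).
have asc_j : rasc C (perm_weyl R s) j by apply: rasc_perm_weyl; rewrite (sb (lo j)) // (sc (hi j)).
have Cij : C i j = -1 by rewrite !mxE (negPf ij) eqxx.
have Cji : C j i = -1 by rewrite !mxE eq_sym (negPf ij) eqxx orbT.
have := tp _ i j (weyl_perm_weyl R s) ij asc_i asc_j Cij Cji.
rewrite /plucker_a2 !perm_weyl_refl.
rewrite -(support_bz (T := b |: S) pw); last first.
  initial_sets memS eqa eqb eqc.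
rewrite -(support_bz (T := a |: (c |: S)) pw); last first.
  initial_sets memS eqa eqb eqc.
rewrite -(support_bz (T := a |: S) pw); last first.
  initial_sets memS eqa eqb eqc.
rewrite -(support_bz (T := b |: (c |: S)) pw); last first.
  initial_sets memS eqa eqb eqc.
rewrite -(support_bz (T := c |: S) pw); last first.
  initial_sets memS eqa eqb eqc.
rewrite -(support_bz (T := a |: (b |: S)) pw) //.
initial_sets memS eqa eqb eqc.
Qed.

End Datum.

(** * The closed formula for the lowering operators *)

(** The induction step shared by the two directions: x and z are minima tied by
    relations with the same constants u, v, y before and after lowering. *)
Lemma min_propagate (R : realType) (x x' y z z' u v c : R) :
  x + u = Num.min v (y + z) -> x' + u = Num.min v (y + z') ->
  z' = Num.min z (u + c) -> x' = Num.min x (y + c).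
Proof.
by rewrite !minElt; do !case: ifP; lra.
Qed.

Section Lowering.
Variables (R : realType) (n : nat).
Local Notation r := (ell n).
Local Notation C := (cartanA n).
Local Notation chw w i := (fundweight R i *m invmx w).
Variables (j : 'I_r) (mu mu' : 'M[R]_r -> 'cV[R]_r).
Hypothesis mv_mu : mv_datum_simply_laced C mu.
Hypothesis mv_mu' : mv_datum_simply_laced C mu'.
Hypothesis mu'1 : mu' 1%:M = mu 1%:M - coroot R j.
Hypothesis mu'_desc : forall w, weyl C w -> ldesc C w j -> mu' w = mu w.
Implicit Types (s t : 'S_r.+1) (S T : {set 'I_r.+1}) (i : 'I_r) (w : 'M[R]_r).

Let p := lo j.
Let q := hi j.
Definition lowering_const := bz mu 1%:M j - bz mu (refl R C j) j - 1.
Local Notation c := lowering_const.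

(** If w Lambda_i takes the value 0 on h_j it is also s_j w Lambda_i, and one of
    w, s_j w has s_j as a left descent; if it takes the value -1, then w has. *)
Lemma lowered_unchanged w i : weyl C w -> (chw w i) 0 j != 1 -> bz mu' w i = bz mu w i.
Proof.
move=> ww; have /= [x_val x1 xN1 x0] := chamber_values i j ww.
have desc : ldesc C w j -> bz mu' w i = bz mu w i by move=> d; rewrite /bz mu'_desc.
case: x0 => [/desc //|d' x_neq1]; move: x_val xN1; rewrite !inE (negPf x_neq1) orbF.
case/orP=> /eqP ex; first by move=> /(_ ex)/desc.
move=> _; have [pw _ _] := mv_mu; have [pw' _ _] := mv_mu'.
have eq_ch : chw w i = chw (refl R C j *m w) i.
  by rewrite chamber_refl // mul_refl ex scale0r subr0.
rewrite (bz_chamber pw' ww (weyl_refl j ww) eq_ch) (bz_chamber pw ww (weyl_refl j ww) eq_ch).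
by rewrite /bz (mu'_desc (weyl_refl j ww) d').
Qed.

(** The witnesses a and b make T nonempty and proper, hence a chamber weight. *)
Lemma support_unchanged T a b : a \in T -> b \notin T -> (q \in T) || (p \notin T) ->
  support_value mu' T = support_value mu T.
Proof.
move=> aT bT pqT; case: (@chamber_set n T) => [||s [i eT]].
- by apply/set0Pn; exists a.
- by apply: contraNneq bT => ->; rewrite inE.
have [pw _ _] := mv_mu; have [pw' _ _] := mv_mu'.
rewrite (support_bz pw eT) (support_bz pw' eT); apply: lowered_unchanged.
  exact: weyl_perm_weyl.
rewrite chamber_row -eT mxE -/p -/q indicator_sub_eq1.
by case: (q \in T) (p \in T) pqT => [] [].
Qed.

Lemma pq_neq : (p != q) * (q != p).
Proof.
by rewrite eq_sym; split; apply/eqP=> /(congr1 val); rewrite /= /bump; lia.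
Qed.

Definition lowering_formula S :=
  support_value mu' (p |: S) = Num.min (support_value mu (p |: S)) (support_value mu (q |: S) + c).

(** Here both sides are values at the vertex of e and its neighbour: the vertex
    of e moves by - h_j, and c is defined so that the second argument of the
    minimum is M - 1. *)
Lemma lowering_formula_initial : lowering_formula [set a : 'I_r.+1 | (a < p)%N].
Proof.
have [pw _ _] := mv_mu; have [pw' _ _] := mv_mu'.
have ep : p |: [set a : 'I_r.+1 | (a < p)%N] = [set a : 'I_r.+1 | ((1 : 'S_r.+1)^-1%g a <= j)%N].
  apply/setP=> a; rewrite !inE invg1 perm1 -val_eqE /=; lia.
have eq : q |: [set a : 'I_r.+1 | (a < p)%N] = [set a : 'I_r.+1 | ((adj j)^-1%g a <= j)%N].
  apply/setP=> a; rewrite !inE tpermV val_adj -val_eqE /= /bump leq0n add1n.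
  by do !case: eqP; lia.
rewrite /lowering_formula (support_bz pw ep) (support_bz pw' ep) (support_bz pw eq).
rewrite perm_weyl1 perm_weyl_adj /c.
have -> : bz mu' 1%:M j = bz mu 1%:M j - 1.
  rewrite /bz mu'1 pairingBr pairing_coroot; congr (_ - _).
  by rewrite -(perm_weyl1 R) perm_weylV invg1 perm_weyl1 mulmx1 !mxE !eqxx.
by rewrite minElt; case: ifP; lra.
Qed.

Lemma pq_lt : (p < q)%N.
Proof. by rewrite /= /bump; lia. Qed.

(** The values entering the constants of the three-term relations for S, p, q
    and a further element a: none contains p without q. *)
Lemma support_unchanged_pq S a :
  a != p -> a != q -> a \notin S -> p \notin S -> q \notin S ->
  [/\ support_value mu' (a |: S) = support_value mu (a |: S),
      support_value mu' (q |: S) = support_value mu (q |: S),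
      support_value mu' (p |: (q |: S)) = support_value mu (p |: (q |: S)) &
      support_value mu' (q |: (a |: S)) = support_value mu (q |: (a |: S))].
Proof.
move=> ap aq aS pS qS.
have nE := (negPf ap, negPf aq, eq_sym p a, eq_sym q a, negPf aS, negPf pS,
           negPf qS, pq_neq.1, negPf pq_neq.1, negPf pq_neq.2).
split.
- by apply: (support_unchanged (a := a) (b := p)); rewrite !inE !nE ?eqxx.
- by apply: (support_unchanged (a := q) (b := p)); rewrite !inE !nE ?eqxx.
- by apply: (support_unchanged (a := q) (b := a)); rewrite !inE !nE ?eqxx ?orbT.
- by apply: (support_unchanged (a := q) (b := p)); rewrite !inE !nE ?eqxx.
Qed.

(** The three-term relation of S and a < p < q. *)
Lemma lowering_formula_remove S (a : 'I_r.+1) :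
  (a < p)%N -> a \notin S -> p \notin S -> q \notin S ->
  lowering_formula (a |: S) -> lowering_formula S.
Proof.
move=> lt_ap aS pS qS; have pq := pq_lt.
have ap : a != p by rewrite -val_eqE ltn_eqF.
have aq : a != q by rewrite -val_eqE ltn_eqF // (ltn_trans lt_ap).
have := support_plucker mv_mu lt_ap pq aS pS qS.
have := support_plucker mv_mu' lt_ap pq aS pS qS.
have [-> -> -> E] := support_unchanged_pq ap aq aS pS qS.
rewrite !(finset.setUCA [set a]) E => tp' tp IH.
exact: min_propagate tp tp' IH.
Qed.

(** The three-term relation of S and p < q < b. *)
Lemma lowering_formula_add S (b : 'I_r.+1) :
  (q < b)%N -> b \notin S -> p \notin S -> q \notin S ->
  lowering_formula S -> lowering_formula (b |: S).
Proof.
move=> lt_qb bS pS qS; have pq := pq_lt.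
have bq : b != q by rewrite eq_sym -val_eqE ltn_eqF.
have bp : b != p by rewrite eq_sym -val_eqE ltn_eqF // (ltn_trans pq).
have := support_plucker mv_mu pq lt_qb pS qS bS.
have := support_plucker mv_mu' pq lt_qb pS qS bS.
have [-> -> -> ->] := support_unchanged_pq bp bq bS pS qS.
(* Put the relations in the shape of min_propagate, with the roles of the two
   arguments of the minimum exchanged. *)
rewrite minC [in X in _ -> X -> _]minC !(addrC (support_value _ (q |: S))).
rewrite !(addrC _ (support_value mu (q |: (b |: S)))) => tp' tp IH.
exact: min_propagate tp tp' IH.
Qed.

(** From the initial set {a < p}, remove elements below p, then add elements
    above q. *)
Lemma lowering_formula_all S : p \notin S -> q \notin S -> lowering_formula S.
Proof.
pose S0 := [set a : 'I_r.+1 | (a < p)%N].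
have p0 : p \notin S0 by rewrite inE ltnn.
have q0 : q \notin S0 by rewrite inE -leqNgt ltnW // pq_lt.
have notin_sub (a : 'I_r.+1) (U V : {set 'I_r.+1}) : a \notin V -> U \subset V -> a \notin U.
  by move=> aV /fintype.subsetP sUV; apply: contra aV; apply: sUV.
have below : forall k S, #|S0 :\: S| = k -> S \subset S0 -> lowering_formula S.
  elim=> [|k IHk] {}S.
    move/eqP; rewrite cards_eq0 finset.setD_eq0 => sS0 sS.
    have -> : S = S0 by apply/eqP; rewrite finset.eqEsubset sS.
    exact: lowering_formula_initial.
  move=> card_k sS; have /card_gt0P[a aD] : (0 < #|S0 :\: S|)%N by rewrite card_k.
  move: (aD); rewrite !inE => /andP[aS ap].
  apply: (lowering_formula_remove ap aS (notin_sub _ _ _ p0 sS) (notin_sub _ _ _ q0 sS)).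
  apply: IHk.
    by rewrite finset.setUC -finset.setDDl; move: card_k; rewrite (cardsD1 a) aD => -[].
  by rewrite finset.subUset sS andbT finset.sub1set inE.
(* Induction on the number of elements of S outside S0; all of them are above q. *)
have [k] := ubnP #|S :\: S0|; elim: k S => // k IHk S lt_k pS qS.
have [/eqP|[b bD]] := set_0Vmem (S :\: S0).
  by rewrite finset.setD_eq0; apply: below.
move: (bD); rewrite !inE -leqNgt => /andP[le_pb bS].
rewrite -(finset.setD1K bS); apply: lowering_formula_add;
  rewrite ?inE ?eqxx ?(negPf pS) ?(negPf qS) ?andbF //.
  have : b != p by apply: contraNneq pS => <-.
  have : b != q by apply: contraNneq qS => <-.
  by move: le_pb; rewrite -!val_eqE /p /q /= /bump; lia.
apply: IHk; rewrite ?inE ?(negPf pS) ?(negPf qS) ?andbF //.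
apply: leq_ltn_trans (_ : #|(S :\: S0) :\ b| < k)%N; last first.
  by move: lt_k; rewrite (cardsD1 b) bD.
by rewrite finset.setDDl finset.setUC -finset.setDDl.
Qed.

(** This describes lowering by the chamber weights alone; all fundamental weights
    of type A being minuscule, there is a single case with a minimum. *)
Lemma lowered_bz w i : weyl C w -> bz mu' w i =
  if (chw w i) 0 j == 1 then Num.min (bz mu w i) (bz mu (refl R C j *m w) i + c)
  else bz mu w i.
Proof.
move=> ww; case: ifPn => [|]; last exact: lowered_unchanged.
have [s ->] := weylP ww; have [pw _ _] := mv_mu; have [pw' _ _] := mv_mu'.
set T := [set a : 'I_r.+1 | (s^-1%g a <= i)%N].
rewrite chamber_row mxE -/p -/q -/T refl_perm_weyl indicator_sub_eq1 => /andP[pT qT].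
rewrite -(support_bz pw' (erefl T)) -(support_bz pw (erefl T)).
rewrite -(@support_bz R n mu _ i (q |: (T :\ p)) pw); last first.
  apply/setP=> a; rewrite !inE invMg tpermV permM /adj.
  case: tpermP => [->|->|/eqP ne_p /eqP ne_q].
  - rewrite eqxx orbF (negPf (pq_neq.1 : lo j != hi j)).
    by move: qT; rewrite inE => /negPf->.
  - by rewrite -/q eqxx; move: pT; rewrite inE => ->.
  - by rewrite -/p -/q in ne_p ne_q *; rewrite (negPf ne_q) ne_p.
rewrite -{1 2}(finset.setD1K pT); apply: lowering_formula_all.
  by rewrite !inE eqxx.
by rewrite inE (negPf qT) andbF.
Qed.

End Lowering.

(** * The diagram automorphism *)

Section Diagram.
Variables (R : realType) (n : nat).
Local Notation r := (ell n).
Local Notation C := (cartanA n).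
Local Notation chw w i := (fundweight R i *m invmx w).
Implicit Types (i j : 'I_r) (v w : 'M[R]_r).

Lemma omegaIK : involutive (@omegaI n).
Proof. exact: rev_ordK. Qed.

Lemma cartanA_omega i j : C (omegaI i) (omegaI j) = C i j.
Proof.
rewrite !mxE -!val_eqE /=; have := ltn_ord i; have := ltn_ord j.
by move=> lt_j lt_i; do !case: eqP => ? //=; lia.
Qed.

Lemma omegaW_mul v w : omegaW (v *m w) = omegaW v *m omegaW w.
Proof.
apply/matrixP=> i k; rewrite !mxE (reindex_inj (inv_inj omegaIK)).
by apply: eq_bigr => j _; rewrite !mxE.
Qed.

Lemma omegaW1 : omegaW (1%:M : 'M[R]_r) = 1%:M.
Proof. by apply/matrixP=> i k; rewrite !mxE (inj_eq (inv_inj omegaIK)). Qed.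

Lemma omegaW_refl j : omegaW (refl R C j) = refl R C (omegaI j).
Proof.
apply/matrixP=> i k; rewrite mxE !reflE (inj_eq (inv_inj omegaIK)).
by rewrite -(cartanA_omega k) omegaIK -(inj_eq (inv_inj omegaIK) i (omegaI j)) omegaIK.
Qed.

Lemma weyl_omegaW w : weyl C w -> weyl C (omegaW w).
Proof.
case=> l ->; exists (map (@omegaI n) l); rewrite /word_prod; elim: l => [|j l IHl].
  by rewrite !big_nil omegaW1.
by rewrite /= !big_cons omegaW_mul IHl omegaW_refl.
Qed.

Lemma omegaW_inv w : w \in unitmx -> invmx (omegaW w) = omegaW (invmx w).
Proof.
move=> wu; have ww : omegaW (invmx w) *m omegaW w = 1%:M.
  by rewrite -omegaW_mul mulVmx // omegaW1.
have [_ wu'] := mulmx1_unit ww.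
by rewrite -[RHS]mulmx1 -(mulmxV wu') mulmxA ww mul1mx.
Qed.

Lemma chamber_entry w i k : (chw w i) 0 k = invmx w i k.
Proof. by rewrite -rowE mxE. Qed.

(** Composition with the automorphism carries w Lambda_i to the weight given by
    the images of w and i. *)
Lemma bz_omega (mu : 'M[R]_r -> 'cV[R]_r) w i : w \in unitmx ->
  bz (fun w => omegaH (mu (omegaW w))) w i = bz mu (omegaW w) (omegaI i).
Proof.
move=> wu; rewrite /bz /pairing !mxE (reindex_inj (inv_inj omegaIK)).
apply: eq_bigr => k _.
by rewrite !chamber_entry omegaW_inv // !mxE !omegaIK.
Qed.

End Diagram.

(** * Containment and minimality of the lowered polytope *)

Section Conclusion.
Local Open Scope classical_set_scope.
Local Open Scope ring_scope.
Variables (R : realType) (n : nat) (hn : (1 < n)%N).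
Local Notation r := (ell n).
Local Notation C := (cartanA n).
Local Notation chw w i := (fundweight R i *m invmx w).
Local Notation m := (midI hn).
Local Notation sn := (refl R C m).
Implicit Types (i j : 'I_r) (v w : 'M[R]_r) (mu : 'M[R]_r -> 'cV[R]_r).

Lemma omegaI_mid : omegaI m = m.
Proof. by apply: val_inj => /=; rewrite /ell; lia. Qed.

Lemma s_omega_top : s_omega R hn (topI hn) = sn.
Proof. by rewrite /s_omega eqxx. Qed.

Lemma weyl_omega_refl w : weyl_omega w -> weyl_omega (sn *m w).
Proof.
by case=> ww ow; split; [apply: weyl_refl | rewrite omegaW_mul omegaW_refl omegaI_mid ow].
Qed.

Variables mu mu' : 'M[R]_r -> 'cV[R]_r.
Local Notation c := (shift_const hn mu).
Hypothesis pw_mu : pseudo_weyl C mu.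
Hypothesis mu'E : forall w i, weyl C w -> bz mu' w i =
  if (chw w i) 0 m == 1 then Num.min (bz mu w i) (bz mu (sn *m w) i + c)
  else bz mu w i.

(** The middle node is fixed by the automorphism, so all terms of the closed
    formula are invariant. *)
Lemma lowered_omega : omega_invariant mu -> omega_invariant mu'.
Proof.
move=> inv_mu w ww; have wu := weyl_unit ww; have wo := weyl_omegaW ww.
have bz_inv v i : weyl C v -> bz mu (omegaW v) (omegaI i) = bz mu v i.
  by move=> wv; rewrite -bz_omega ?weyl_unit // /bz inv_mu.
apply: (vertex_inj (mu := fun w => omegaH (mu' (omegaW w))) wu) => i.
rewrite bz_omega // !mu'E // !chamber_entry bz_inv //.
rewrite omegaW_inv // mxE omegaIK omegaI_mid.
rewrite -[in sn *m omegaW w]omegaI_mid -omegaW_refl -omegaW_mul bz_inv //.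
exact: weyl_refl.
Qed.

Lemma bz_lowered_le w i : weyl C w -> bz mu' w i <= bz mu w i.
Proof. by move=> ww; rewrite mu'E //; case: ifP => // _; rewrite ge_min lexx. Qed.

Lemma lowered_contains w : weyl C w -> tildeP mu' (mu w).
Proof.
move=> ww v [wv _]; apply/ge_weylE => i.
exact: le_trans (bz_lowered_le i wv) (bz_le i pw_mu wv ww).
Qed.

Lemma pairing_sigma (l : 'rV[R]_r) a h :
  pairing l (sigma hn a h) = pairing (l *m sn) h + a * l 0 m.
Proof. by rewrite /sigma pairingDr pairingZr pairing_coroot pairing_mul. Qed.

(** For the value x of v Lambda_i on h_n, the pairing with sigma (mu_w) is that of
    v Lambda_i - x alpha_n with mu_w, plus c x.  The hypothesis on alpha_n is
    what x = -1 requires; for x = 1 the pairing is at least the second argument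
    of the minimum. *)
Lemma lowered_contains_sigma w : weyl C w ->
  c <= pairing (simple_root R C m) (mu w) -> tildeP mu' (sigma hn c (mu w)).
Proof.
move=> ww le_c v [wv _]; apply/ge_weylE => i; rewrite -/(bz mu' v i) pairing_sigma.
have le_v := bz_le i pw_mu wv ww.
have [x_val _ _ _] := chamber_values i m wv.
rewrite mu'E //; move: x_val; rewrite !inE => /or3P[] /eqP ex; rewrite ex.
- rewrite mul_refl ex eq_sym -subr_eq0 opprK -mulr2n pnatr_eq0 /=.
  by rewrite scaleN1r opprK /pairing mulmxDl mxE -!/(pairing _ _); lra.
- by rewrite mul_refl ex scale0r subr0 mulr0 addr0 eq_sym oner_eq0.
- rewrite eqxx mulr1 -chamber_refl // ge_min lerD2r; apply/orP; right.
  by apply: bz_le; rewrite ?weyl_refl //; apply: weyl_refl.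
Qed.

(** The chamber weights are compared one at a time.  When the value on h_n is 1,
    either the sigma-image of the vertex at s_n v bounds the value of mu'' by the
    second argument of the minimum, or the first argument is the smaller one. *)
Lemma lowered_minimal mu'' : pseudo_weyl C mu'' -> lowering_conditions hn mu mu'' ->
  tildeP mu' `<=` tildeP mu''.
Proof.
move=> pw'' [minus'' _ plus'' sigma''] h Ph v ov; have [wv _] := ov.
apply/ge_weylE => i; move: (Ph v ov) => /ge_weylE/(_ i); apply: le_trans.
rewrite -/(bz mu'' v i) -/(bz mu' v i) mu'E //.
have wu := weyl_refl m wv; have ou := weyl_omega_refl ov.
have [x_val x1 xN1 x0] := chamber_values i m wv.
have minusP w : weyl_omega w -> ldesc C w m -> mu'' w = mu w.
  by move=> ow dw; apply: minus''; split=> //; rewrite s_omega_top.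
case: ifPn => [/eqP ex|x_neq1].
  have len_v := x1 ex; have Pv : tildeP mu'' (mu v).
    by apply: plus''; split=> //; rewrite s_omega_top.
  have le_v : bz mu'' v i <= bz mu v i by move: (Pv v ov) => /ge_weylE/(_ i).
  rewrite le_min le_v /=.
  have [le_c|lt_c] := leP c (pairing (simple_root R C m) (mu (sn *m v))).
    have /(_ v ov)/ge_weylE/(_ i) : tildeP mu'' (sigma hn c (mu (sn *m v))).
      by apply: sigma''; rewrite // /weyl_omega_minus /= s_omega_top mulmxA reflK mul1mx.
    by rewrite pairing_sigma ex mulr1 -chamber_refl.
  apply: (le_trans le_v); have := bz_le i pw_mu wv wu.
  have -> : bz mu (sn *m v) i = pairing (chw v i) (mu (sn *m v))
      - pairing (simple_root R C m) (mu (sn *m v)).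
    by rewrite /bz chamber_refl // mul_refl ex scale1r pairingBl.
  lra.
suff -> : bz mu'' v i = bz mu v i by [].
case: x0 => [d|d]; first by rewrite /bz minusP.
move: x_val; rewrite !inE (negPf x_neq1) orbF => /orP[] /eqP ex.
  by rewrite /bz minusP // xN1.
have eq_ch : chw v i = chw (sn *m v) i by rewrite chamber_refl // mul_refl ex scale0r subr0.
rewrite (bz_chamber pw'' wv wu eq_ch) (bz_chamber pw_mu wv wu eq_ch).
by rewrite /bz minusP.
Qed.

End Conclusion.

Local Open Scope classical_set_scope.
Local Open Scope ring_scope.

(** The vertices are determined by the polytope, so the tropical relations of P and
    P' and the description of the lowering operator all apply to mu and mu'. *)
Theorem theorem3p2p4 (R : realType) (n : nat) (hn : (1 < n)%N)
    (Theta : 'M[R]_n -> 'M[R]_(ell n)) (hTheta : is_Theta hn Theta)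
    (Phat : set 'cV[R]_n) (hPhat : MV_hat Phat)
    (P : set 'cV[R]_(ell n)) (hP : MV_omega P) (hPhi : is_Phi hn Theta P Phat)
    (mu : 'M[R]_(ell n) -> 'cV[R]_(ell n)) (hmu : is_ggms (cartanA n) mu P)
    (P' : set 'cV[R]_(ell n)) (hP' : is_lowering_omega hn (topI hn) P P')
    (mu' : 'M[R]_(ell n) -> 'cV[R]_(ell n))
    (hmu' : is_ggms (cartanA n) mu' P') :
  (pseudo_weyl_omega mu' /\ lowering_conditions hn mu mu') /\
  (forall mu'' : 'M[R]_(ell n) -> 'cV[R]_(ell n),
     pseudo_weyl_omega mu'' -> lowering_conditions hn mu mu'' ->
     tildeP mu' `<=` tildeP mu'').
Proof.
have [pw_mu _] := hmu; have [pw_mu' _] := hmu'.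
have [nu [mv_nu inv_nu eP]] := hP.
have ggms_nu : is_ggms (cartanA n) nu P by case: mv_nu.
move: hP'; rewrite /is_lowering_omega eqxx => -[[[nu' mv_nu' eP']]].
have ggms_nu' : is_ggms (cartanA n) nu' P' by case: mv_nu'.
move=> [mu1 [mu1' [ggms_mu1 ggms_mu1' mu1'1 mu1'_desc]]] _.
have w1 : weyl (cartanA n) (1%:M : 'M[R]_(ell n)) by exists [::]; rewrite /word_prod big_nil.
have mu'1 : mu' 1%:M = mu 1%:M - coroot R (midI hn).
  by rewrite (ggms_unique hmu' ggms_mu1' w1) mu1'1 (ggms_unique ggms_mu1 hmu w1).
have mu'_desc w : weyl (cartanA n) w -> ldesc (cartanA n) w (midI hn) -> mu' w = mu w.
  move=> ww dw; rewrite (ggms_unique hmu' ggms_mu1' ww) mu1'_desc //.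
  exact: ggms_unique ggms_mu1 hmu ww.
have muE w : weyl (cartanA n) w -> mu w = nu w by apply: ggms_unique hmu ggms_nu.
have mu'E w : weyl (cartanA n) w -> mu' w = nu' w by apply: ggms_unique hmu' ggms_nu'.
have nu'1 : nu' 1%:M = nu 1%:M - coroot R (midI hn) by rewrite -mu'E // -muE.
have nu'_desc w : weyl (cartanA n) w -> ldesc (cartanA n) w (midI hn) -> nu' w = nu w.
  by move=> ww dw; rewrite -mu'E // -muE // mu'_desc.
have bz_mu' w i : weyl (cartanA n) w -> bz mu' w i =
    if (fundweight R i *m invmx w) 0 (midI hn) == 1
    then Num.min (bz mu w i) (bz mu (refl R (cartanA n) (midI hn) *m w) i + shift_const hn mu)
    else bz mu w i.
  move=> ww; have := lowered_bz mv_nu mv_nu' nu'1 nu'_desc i ww.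
  have wu := weyl_refl (midI hn) ww; have wr := weyl_refl (midI hn) w1.
  rewrite mulmx1 in wr.
  by rewrite /lowering_const /shift_const /bz -!muE // -!mu'E.
have inv_mu : omega_invariant mu.
  by move=> w ww; rewrite !muE //; [apply: inv_nu | apply: weyl_omegaW].
split; last by move=> mu'' [pw'' _]; apply: (lowered_minimal pw_mu bz_mu').
split; first by split=> //; apply: (lowered_omega bz_mu').
split.
- by move=> w [[ww _]]; rewrite s_omega_top; apply: mu'_desc.
- by rewrite mu'1 /h_omega eqxx.
- by move=> w [[ww _] _]; apply: (lowered_contains pw_mu bz_mu' ww).
- by move=> w [[ww _] _]; apply: (lowered_contains_sigma pw_mu bz_mu' ww).
Qed.
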